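(* Let $(A,B)$ be a shifted perforated $(\mathbf{a},\mathbf{b})$-pair such that $B$ extends $A$, and let $({}^AB,A_B)$ be the result of the shifted switching process applied to $(A,B)$. Then: (a) ${}^AB\cup A_B$ has the same shape as $A\cup B$; (b) $A_B$ extends ${}^AB$, and both $A_B$ and ${}^AB$ are shifted Young tableaux of border strip shape.
   Context: Shifted shapes: for a strict partition $\lambda=(\lambda_1>\cdots>\lambda_\ell>0)$, $S(\lambda)=\{(i,j)\in\mathbb{Z}^2:1\le i\le\ell,\ i\le j\le\lambda_i+i-1\}$ (matrix coordinates); boxes $(i,i)$ form the main diagonal. For strict partitions $\mu\subseteq\lambda$, $\lambda/\mu=S(\lambda)\setminus S(\mu)$. If $\nu\subseteq\mu\subseteq\lambda$, $\lambda/\mu$ extends $\mu/\nu$; a filling extends another if its shape extends the other's shape. East/south neighbors of $(i,j)$: $(i,j+1)$, $(i+1,j)$; $(k,l)$ is southeast of $(i,j)$ if $k\ge i,l\ge j$. A border strip is a skew shifted shape containing no $\{(i,j),(i+1,j+1)\}$; a double border strip one containing no $\{(i,j),(i+1,j+1),(i+2,j+2)\}$. Letters $X=\{1'<1<2'<2<\cdots\}$; bold $\mathbf{a}$ means $a$ or $a'$. A shifted Young tableau (SYT) of shape $\lambda/\mu$ is a filling with letters of $X$, weakly increasing along rows and down columns, with each column containing at most one unprimed $k$ and each row at most one $k'$, for each $k$. Shifted perforated $\mathbf{a}$-tableau in a double border strip $\theta$: filling of some boxes of $\theta$ by $a',a$ with no $a'$-box southeast of an $a$-box, at most one $a$ per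 column, at most one $a'$ per row, at most one box on the main diagonal. A shifted perforated $(\mathbf{a},\mathbf{b})$-pair $(A,B)$ of shape $\theta$: $A$ a perforated $\mathbf{a}$-tableau and $B$ a perforated $\mathbf{b}$-tableau whose shapes partition $\theta$; boxes remember whether they are $\mathbf{a}$-boxes or $\mathbf{b}$-boxes. Switches at an $\mathbf{a}$-box $c=(i,j)$ with entry $\alpha$, $E=(i,j+1)$, $S=(i+1,j)$ (entries move with their labels): (S3) $j=i$, $E$ a $\mathbf{b}$-box with entry $b'$, $(i+1,i+1)$ a $\mathbf{b}$-box with entry $\beta$: new entries $\beta$ at $(i,i)$, $b$ at $(i,i+1)$ ($\mathbf{b}$-boxes), $\alpha$ at $(i+1,i+1)$. (S4) $j=i+1$, $\alpha=a$, $(i,i)$ an $\mathbf{a}$-box with entry $\alpha_0$, $S=(i+1,i+1)$ a $\mathbf{b}$-box with entry $\beta$, $E$ not a $\mathbf{b}$-box: new entries $\beta$ at $(i,i)$, $a'$ at $(i,i+1)$, $\alpha_0$ at $(i+1,i+1)$. (S7) as (S4) but $E$ is a $\mathbf{b}$-box with entry $b$ (left unchanged). (S5) $E,S$ both $\mathbf{b}$-boxes, $E$ has entry $b'$: interchange $c$ and $E$. (S6) $E,S$ both $\mathbf{b}$-boxes, $E$ has entry $b$, not case (S7): interchange $c$ and $S$. (S1) only $E$ is a $\mathbf{b}$-box, not case (S3): interchange $c$ and $E$. (S2) only $S$ is a $\mathbf{b}$-box, not case (S4): interchange $c$ and $S$. A filling $U$ is fully switched if no $\mathbf{a}$-box has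 a $\mathbf{b}$-box as east or south neighbor. Otherwise $\Box(U)$ is the easternmost $\mathbf{a}$-box with entry $a$ whose east or south neighbor is a $\mathbf{b}$-box, or if none exists, the southernmost $\mathbf{a}$-box with entry $a'$ with this property; $\sigma(U)$ is obtained by applying the applicable switch to $\Box(U)$. Shifted switching process: starting from $A\cup B$, apply $\sigma$ repeatedly until the filling is fully switched; $A_B$ denotes the resulting filling of the $\mathbf{a}$-boxes and ${}^AB$ that of the $\mathbf{b}$-boxes. *)

(* Defs.v *)
From mathcomp Require Import all_boot all_order finmap.

Set Implicit Arguments.
Unset Strict Implicit.
Unset Printing Implicit Defensive.

Import Order.TTheory.
Local Open Scope fset_scope.
Local Open Scope fmap_scope.

(** * Shifted shapes *)

(* Boxes are in matrix coordinates, numbered from 1; the paper's boxes lie in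
   Z^2, but every diagram only has boxes with positive coordinates. *)
Notation box := (nat * nat)%type.

Definition east (c : box) : box := (c.1, c.2.+1).
Definition south (c : box) : box := (c.1.+1, c.2).
Definition next_diag (c : box) : box := (c.1.+1, c.2.+1).

(* [southeast c d]: d is (weakly) southeast of c. *)
Definition southeast (c d : box) : bool := (c.1 <= d.1) && (c.2 <= d.2).

Definition strict_partition (la : seq nat) : bool :=
  sorted gtn la && (0 \notin la).

(* The part called la_i in the paper is [nth 0 la i.-1]; the bound
   j <= la_i + i - 1 is written j < la_i + i to avoid truncated subtraction. *)
Definition shifted_diagram (la : seq nat) : pred box :=
  fun c => [&& 1 <= c.1 <= size la, c.1 <= c.2 & c.2 < nth 0 la c.1.-1 + c.1].

Definition subpartition (mu la : seq nat) : Prop :=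
  {subset shifted_diagram mu <= shifted_diagram la}.

Definition skew_diagram (la mu : seq nat) : pred box :=
  fun c => (c \in shifted_diagram la) && (c \notin shifted_diagram mu).

Definition skew_shifted_shape (D : {fset box}) : Prop :=
  exists la mu : seq nat,
    [/\ strict_partition la, strict_partition mu, subpartition mu la
      & D =i skew_diagram la mu].

(* [extends D' D]: the shape D' extends the shape D. *)
Definition extends (D' D : {fset box}) : Prop :=
  exists la mu nu : seq nat,
    [/\ [/\ strict_partition la, strict_partition mu & strict_partition nu],
        subpartition nu mu, subpartition mu la,
        D' =i skew_diagram la mu & D =i skew_diagram mu nu].

Definition border_strip (D : {fset box}) : Prop :=
  skew_shifted_shape D /\
  forall c : box, ~ (c \in D /\ next_diag c \in D).

Definition double_border_strip (D : {fset box}) : Prop :=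
  skew_shifted_shape D /\
  forall c : box,
    ~ [/\ c \in D, next_diag c \in D & next_diag (next_diag c) \in D].

(** * Letters and tableaux *)

(* (k, false) is k' and (k, true) is k, so that the lexicographic order is
   1' < 1 < 2' < 2 < ...  The alphabet X consists of the letters with k > 0. *)
Notation letter := (nat *l bool)%type.
Definition primed (k : nat) : letter := (k, false).
Definition unprimed (k : nat) : letter := (k, true).

Notation filling := {fmap box -> letter}.

Definition shifted_young_tableau (T : filling) : Prop :=
  [/\ skew_shifted_shape (domf T),
      forall c x, T.[? c] = Some x -> 0 < x.1,
      forall i j j' x y, j <= j' ->
        T.[? (i, j)] = Some x -> T.[? (i, j')] = Some y -> (x <= y)%O,
      forall i i' j x y, i <= i' ->
        T.[? (i, j)] = Some x -> T.[? (i', j)] = Some y -> (x <= y)%O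
    & (forall i i' j k, T.[? (i, j)] = Some (unprimed k) ->
        T.[? (i', j)] = Some (unprimed k) -> i = i') /\
      (forall i j j' k, T.[? (i, j)] = Some (primed k) ->
        T.[? (i, j')] = Some (primed k) -> j = j')].

Definition perforated_tableau (theta : {fset box}) (a : nat) (A : filling) :
    Prop :=
  [/\ domf A `<=` theta,
      forall c x, A.[? c] = Some x -> x = primed a \/ x = unprimed a,
      forall c d, A.[? c] = Some (unprimed a) -> A.[? d] = Some (primed a) ->
        ~~ southeast c d,
      (forall i i' j, A.[? (i, j)] = Some (unprimed a) ->
        A.[? (i', j)] = Some (unprimed a) -> i = i') /\
      (forall i j j', A.[? (i, j)] = Some (primed a) ->
        A.[? (i, j')] = Some (primed a) -> j = j')
    & forall i i', (i, i) \in domf A -> (i', i') \in domf A -> i = i'].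

Definition perforated_pair (theta : {fset box}) (a b : nat) (A B : filling) :
    Prop :=
  [/\ double_border_strip theta,
      perforated_tableau theta a A,
      perforated_tableau theta b B,
      domf A `|` domf B = theta
    & [disjoint domf A & domf B]].

(** * Switching *)

(* A filling by a-boxes and b-boxes is the pair of the filling of its a-boxes
   and the filling of its b-boxes.  Thus a box remembers its kind even if the
   letters a and b coincide. *)
Notation pair_filling := (filling * filling)%type.

(* Moves the entry of c to d. *)
Definition move_entry (T : filling) (c d : box) : filling :=
  if T.[? c] is Some x then T.[~ c].[d <- x] else T.

(* Interchanges the a-box c with the b-box d. *)
Definition interchange (U : pair_filling) (c d : box) : pair_filling :=
  (move_entry U.1 c d, move_entry U.2 d c).

Definition switch (a b : nat) (U : pair_filling) (c : box) : pair_filling :=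
  let: (A, B) := U in
  let E := east c in
  let S := south c in
  let W := (c.1, c.1) in
  if [&& c.2 == c.1, B.[? E] == Some (primed b) & next_diag c \in domf B]
  then (* S3 *)
    (move_entry A c (next_diag c),
     (move_entry B (next_diag c) c).[E <- unprimed b])
  else if [&& c.2 == c.1.+1, A.[? c] == Some (unprimed a), W \in domf A,
              S \in domf B
            & (E \notin domf B) || (B.[? E] == Some (unprimed b))]
  then (* S4 if E is not a b-box, S7 if it is *)
    ((move_entry A W S).[c <- primed a], move_entry B S W)
  else if (E \in domf B) && (S \in domf B) then
    if B.[? E] == Some (primed b)
    then (* S5 *) interchange U c E
    else (* S6 *) interchange U c S
  else if E \in domf B then (* S1 *) interchange U c E
  else if S \in domf B then (* S2 *) interchange U c S
  else U.

Definition switchable (U : pair_filling) (c : box) : bool :=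
  (c \in domf U.1) && ((east c \in domf U.2) || (south c \in domf U.2)).

Definition fully_switched (U : pair_filling) : Prop :=
  forall c, ~~ switchable U c.

(* The switchable a-boxes with entry x. *)
Definition candidates (U : pair_filling) (x : letter) : {fset box} :=
  [fset c in domf U.1 | switchable U c && (U.1.[? c] == Some x)].

(* [is_next_box a U c]: c is the box called Box(U) in the paper. *)
Definition is_next_box (a : nat) (U : pair_filling) (c : box) : bool :=
  if candidates U (unprimed a) != fset0 then
    (c \in candidates U (unprimed a)) &&
    [forall d : candidates U (unprimed a), (val d).2 <= c.2]
  else
    (c \in candidates U (primed a)) &&
    [forall d : candidates U (primed a), (val d).1 <= c.1].

Definition sigma (a b : nat) (U : pair_filling) : pair_filling :=
  if [pick c : domf U.1 | is_next_box a U (val c)] is Some c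
  then switch a b U (val c) else U.

(* [switching_result a b U V]: V is the outcome of the switching process
   started at U.  There is at most one such V, as sigma fixes every fully
   switched filling. *)
Definition switching_result (a b : nat) (U V : pair_filling) : Prop :=
  fully_switched V /\ exists n : nat, V = iter n (sigma a b) U.

(* Main.v *)
(* A switch is a local move, so the theorem reduces to three facts.  The sum of
   the coordinates of the a-boxes strictly grows, hence the process stops.  In a
   fully switched pair, the b-boxes form an order ideal of the shape, and a
   perforated tableau whose boxes form a skew shape is a shifted Young tableau on
   a border strip.  What needs work is that every switch of the process yields a
   perforated pair; this fails for arbitrary perforated pairs.  Besides being
   perforated, the pairs met in the process avoid a few local patterns in which
   some b-box lies northwest of some a-box; as B extends A, no such pair of boxes
   exists at the start.  All a-boxes with entry a are switched first, from east to
   west, then those with entry a', from south to north, and three patterns are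
   needed in the first stage only.  In both stages, avoiding the patterns makes
   the next pair perforated, and the patterns stay avoided. *)

From Stdlib Require Import Lia.
Require Import Defs.
From mathcomp Require Import all_boot all_order finmap.

Set Implicit Arguments.
Unset Strict Implicit.
Unset Printing Implicit Defensive.

(** * Grids and forbidden patterns *)

(* [Ap], [Au], [Bp], [Bu] stand for the entries a', a, b', b. *)
Inductive cell := Out | Ap | Au | Bp | Bu.

(** With [Out] off the shape, a switch becomes a few pointwise updates of a total function. The
    numbers a and b disappear, so labels that coincide cause no trouble. *)
Definition grid := nat -> nat -> cell.

Definition is_a v := match v with Ap | Au => true | _ => false end.
Definition is_b v := match v with Bp | Bu => true | _ => false end.

Section Grid.
Local Open Scope coq_nat_scope.

Lemma is_aP v : is_a v <-> v = Ap \/ v = Au.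
Proof. by case: v; split=> //; auto; case. Qed.

Lemma is_bP v : is_b v <-> v = Bp \/ v = Bu.
Proof. by case: v; split=> //; auto; case. Qed.

(** What the local analysis retains of a double border strip, free of partitions. The premise
    [p <= q] in the convexity clause is there because a shifted diagram has no box below the main
    diagonal. *)
Definition region (f : grid) : Prop :=
  [/\ forall i j, f i j <> Out -> i <= j,
      forall i j k l p q, f i j <> Out -> f k l <> Out ->
        i <= p -> p <= k -> j <= q -> q <= l -> p <= q -> f p q <> Out
    & forall i j, f i j <> Out -> f i.+1 j.+1 <> Out -> f i.+2 j.+2 <> Out ->
        False].

(** With [p] and [u] as parameters, one definition serves both the a-boxes and the b-boxes. *)
Definition perforated (f : grid) (p u : cell) : Prop :=
  [/\ forall i j k l, f i j = u -> f k l = p -> i <= k -> j <= l -> False,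
      forall i k j, f i j = u -> f k j = u -> i = k,
      forall i j l, f i j = p -> f i l = p -> j = l
    & forall i k, f i i = p \/ f i i = u -> f k k = p \/ f k k = u -> i = k].

(* In the pictures of the next six definitions, [A] and [B] are an a-box and a
   b-box with any entry, and dots stand for any number of boxes, possibly none.
   The first three patterns never occur during the process; the last three
   never occur as long as some a-box with entry a can be switched. *)

(*  a' ..  b
       B   a'   *)
Definition no_P (f : grid) := forall i j k, f i j = Ap -> f i k.+1 = Bu ->
  f i.+1 k.+1 = Ap -> is_b (f i.+1 k) -> j <= k -> False.

(*  B
       A  ..  B   with B and A on the main diagonal *)
Definition no_D (f : grid) := forall k l, is_b (f k k) -> is_a (f k.+1 k.+1) ->
  is_b (f k.+1 l) -> k.+1 < l -> False.

(*  b
    :   a'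
    A   B    where a' may be in the row of b *)
Definition no_Q (f : grid) := forall i j k k', f k j = Bu -> f k' j.+1 = Ap ->
  is_a (f i j) -> is_b (f i j.+1) -> k <= k' -> k' < i -> False.

(* As [no_Q], with any box of the shape at the place of the lower B. *)
Definition no_Q0 (f : grid) := forall i j k k', f k j = Bu -> f k' j.+1 = Ap ->
  is_a (f i j) -> f i j.+1 <> Out -> k <= k' -> k' < i -> False.

(*  b' ..  a
      A    B    where A may be below b' *)
Definition no_R (f : grid) := forall i j l l', f i l = Bp -> f i j = Au ->
  is_a (f i.+1 l') -> is_b (f i.+1 j) -> l <= l' -> l' < j -> False.

(*  a
    :   b'
    B   :
        a    where a and b' may be in the same row *)
Definition no_T (f : grid) := forall j k m l, f k j = Au -> f m j.+1 = Bp ->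
  is_b (f m.+1 j) -> f l j.+1 = Au -> k <= m -> m < l -> False.

Definition can_switch (f : grid) p q := is_b (f p q.+1) || is_b (f p.+1 q).

Definition easternmost (f : grid) j := forall p q,
  f p q = Au -> can_switch f p q -> q <= j.

Definition no_unprimed (f : grid) := forall p q,
  f p q = Au -> can_switch f p q -> False.

Definition southernmost (f : grid) i := no_unprimed f /\
  forall p q, f p q = Ap -> can_switch f p q -> p <= i.

Definition stage1 (f : grid) : Prop :=
  [/\ perforated f Ap Au, perforated f Bp Bu
    & [/\ no_P f, no_D f, no_Q0 f, no_R f & no_T f]].

Definition stage2 (f : grid) : Prop :=
  [/\ perforated f Ap Au, perforated f Bp Bu & [/\ no_P f, no_D f & no_Q f]].

Definition upd (f : grid) (i j : nat) v : grid :=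
  fun p q => if (p == i) && (q == j) then v else f p q.

Lemma updP (h : grid) (i j : nat) v (p q : nat) :
  (p = i /\ q = j /\ upd h i j v p q = v) \/
  ((p, q) <> (i, j) /\ upd h i j v p q = h p q).
Proof.
rewrite /upd; case: eqP => [->|n]; last by right; split=> // -[].
by case: eqP => [->|n] /=; [left|right; split=> // -[]].
Qed.

(** The uniqueness conditions are symmetric, so it suffices to refute two boxes in strict order. All
    goals then end in [False], the form that the tactics below expect. *)
Lemma perforatedI g p u (k : pred cell) : (forall v, k v <-> v = p \/ v = u) ->
  (forall i j k l, g i j = u -> g k l = p -> i <= k -> j <= l -> False) ->
  (forall i k j, g i j = u -> g k j = u -> i < k -> False) ->
  (forall i j l, g i j = p -> g i l = p -> j < l -> False) ->
  (forall i l, k (g i i) -> k (g l l) -> i < l -> False) -> perforated g p u.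
Proof.
move=> kP NE C R D; split=> // [i l j h1 h2|i j l h1 h2|i l /kP h1 /kP h2].
- case: (i =P l) => // n; exfalso; have [] : i < l \/ l < i by lia.
    exact: C h1 h2.
  exact: C h2 h1.
- case: (j =P l) => // n; exfalso; have [] : j < l \/ l < j by lia.
    exact: R h1 h2.
  exact: R h2 h1.
- case: (i =P l) => // n; exfalso; have [] : i < l \/ l < i by lia.
    exact: D h1 h2.
  exact: D h2 h1.
Qed.

(** * Consequences of the shape and tableau conditions *)

Section Step.
Variable f : grid.
Hypothesis Hr : region f.
Hypothesis Ha : perforated f Ap Au.
Hypothesis Hb : perforated f Bp Bu.

Lemma is_a_in i j : is_a (f i j) -> f i j <> Out.
Proof. by case: (f i j). Qed.

Lemma is_b_in i j : is_b (f i j) -> f i j <> Out.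
Proof. by case: (f i j). Qed.

Lemma region_tri i j : f i j <> Out -> i <= j.
Proof. by case: Hr => H _ _; apply: H. Qed.

Lemma region_cvx p q i j k l : f i j <> Out -> f k l <> Out ->
  i <= p -> p <= k -> j <= q -> q <= l -> p <= q -> f p q <> Out.
Proof. by case: Hr => _ H _ H1 H2 ? ? ? ? ?; apply: (H i j k l). Qed.

(** Convexity fills in the first three boxes of the diagonal that starts at (i, j). *)
Lemma region_thin i j k l v w : f i j = v -> f k l = w -> v <> Out -> w <> Out ->
  i.+2 <= k -> j.+2 <= l -> False.
Proof.
move=> fv fw; rewrite -{}fv -{}fw => H1 H2 h1 h2.
have t := region_tri H1; case: Hr => _ _ H.
by apply: (H i j) => //; apply: (region_cvx H1 H2); lia.
Qed.

(** Convexity leaves no gap in row i, so somewhere an a-box is directly followed by a b-box. The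
    choice of the box to switch forbids such neighbors beyond it, and many configurations are
    refuted in this way. *)
Lemma row_switch i j l : is_a (f i j) -> is_b (f i l) -> j < l ->
  exists m, [/\ j <= m, m < l, is_a (f i m) & is_b (f i m.+1)].
Proof.
elim: l => [|l IH] aj bl jl; first lia.
have [jl'|?] : j = l \/ j < l by lia.
  by subst; exists l; split.
have : f i l <> Out.
  have t := region_tri (is_a_in aj).
  by apply: (@region_cvx i l i j i l.+1); [exact: is_a_in|exact: is_b_in|lia..].
have [a|na] := boolP (is_a (f i l)); first by exists l; split=> //; lia.
case bl': (is_b (f i l)); last by case: (f i l) na bl'.
by move=> _; case: IH => // m [? ? ? ?]; exists m; split=> //; lia.
Qed.

Lemma col_switch i j l : is_a (f j i) -> is_b (f l i) -> j < l ->
  exists m, [/\ j <= m, m < l, is_a (f m i) & is_b (f m.+1 i)].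
Proof.
elim: l => [|l IH] aj bl jl; first lia.
have [jl'|?] : j = l \/ j < l by lia.
  by subst; exists l; split.
have : f l i <> Out.
  have t := region_tri (is_b_in bl).
  by apply: (@region_cvx l i j i l.+1 i); [exact: is_a_in|exact: is_b_in|lia..].
have [a|na] := boolP (is_a (f l i)); first by exists l; split=> //; lia.
case bl': (is_b (f l i)); last by case: (f l i) na bl'.
by move=> _; case: IH => // m [? ? ? ?]; exists m; split=> //; lia.
Qed.

(* In the next lemmas equations between coordinates are separate premises, so
   that the tactics below can discharge them by [lia]. *)

Lemma nau i j k l : f i j = Au -> f k l = Ap -> i <= k -> j <= l -> False.
Proof. by case: Ha => H _ _ _; apply: H. Qed.

Lemma nbu i j k l : f i j = Bu -> f k l = Bp -> i <= k -> j <= l -> False.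
Proof. by case: Hb => H _ _ _; apply: H. Qed.

Lemma colA i j k l : f i j = Au -> f k l = Au -> j = l -> i <> k -> False.
Proof. by case: Ha => _ H _ _ h1 h2 e; subst; move: (H _ _ _ h1 h2). Qed.

Lemma colB i j k l : f i j = Bu -> f k l = Bu -> j = l -> i <> k -> False.
Proof. by case: Hb => _ H _ _ h1 h2 e; subst; move: (H _ _ _ h1 h2). Qed.

Lemma rowA i j k l : f i j = Ap -> f k l = Ap -> i = k -> j <> l -> False.
Proof. by case: Ha => _ _ H _ h1 h2 e; subst; move: (H _ _ _ h1 h2). Qed.

Lemma rowB i j k l : f i j = Bp -> f k l = Bp -> i = k -> j <> l -> False.
Proof. by case: Hb => _ _ H _ h1 h2 e; subst; move: (H _ _ _ h1 h2). Qed.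

Lemma diagA i j k l v w : f i j = v -> f k l = w -> is_a v -> is_a w ->
  i = j -> k = l -> i <> k -> False.
Proof.
by case: Ha => _ _ _ H <- <- /is_aP h1 /is_aP h2 e1 e2; subst; apply; apply: H.
Qed.

Lemma diagB i j k l v w : f i j = v -> f k l = w -> is_b v -> is_b w ->
  i = j -> k = l -> i <> k -> False.
Proof.
by case: Hb => _ _ _ H <- <- /is_bP h1 /is_bP h2 e1 e2; subst; apply; apply: H.
Qed.

Lemma same_box i j k l v w : f i j = v -> f k l = w -> v <> w ->
  i = k -> j = l -> False.
Proof. by move=> h1 h2 n e1 e2; subst. Qed.

Lemma patP i0 j0 i1 j1 i2 j2 i3 j3 w : no_P f ->
  f i0 j0 = Ap -> f i1 j1 = Bu -> f i2 j2 = Ap -> f i3 j3 = w -> is_b w ->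
  [&& i1 == i0, i2 == i0.+1, i3 == i0.+1, j2 == j1 & j3.+1 == j1] ->
  j0 < j1 -> False.
Proof.
move=> H h0 h1 h2 h3 b /and5P[/eqP? /eqP? /eqP? /eqP? /eqP?] h; subst.
by apply: (H _ _ _ h0 h1 h2 b); lia.
Qed.

Lemma patD k0 l0 k1 l1 k2 l2 u v w : no_D f ->
  f k0 l0 = u -> f k1 l1 = v -> f k2 l2 = w -> is_b u -> is_a v -> is_b w ->
  [&& l0 == k0, k1 == k0.+1, l1 == k0.+1 & k2 == k0.+1] -> k1 < l2 -> False.
Proof.
by move=> H h0 h1 h2 b0 a1 b2 /and4P[/eqP? /eqP? /eqP? /eqP?] h; subst;
  apply: (H k0 l2).
Qed.

Lemma patQ0 i j k k' j1 j2 v : no_Q0 f ->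
  f k j = Bu -> f k' j1 = Ap -> f i j2 = v -> is_a v -> f i j1 <> Out ->
  j1 == j.+1 -> j2 == j -> k <= k' -> k' < i -> False.
Proof.
by move=> H h0 h1 h2 a2 h3 /eqP? /eqP? ? ?; subst; apply: (H i j k k').
Qed.

Lemma patQ i j k k' j1 j2 j3 i3 v w : no_Q f ->
  f k j = Bu -> f k' j1 = Ap -> f i j2 = v -> is_a v -> f i3 j3 = w -> is_b w ->
  [&& j1 == j.+1, j2 == j, i3 == i & j3 == j.+1] -> k <= k' -> k' < i -> False.
Proof.
by move=> H h0 h1 h2 a2 h3 b3 /and4P[/eqP? /eqP? /eqP? /eqP?] ? ?; subst;
  apply: (H i j k k').
Qed.

Lemma patT k j m j1 m2 j2 l j3 w : no_T f ->
  f k j = Au -> f m j1 = Bp -> f m2 j2 = w -> is_b w -> f l j3 = Au ->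
  [&& j1 == j.+1, m2 == m.+1, j2 == j & j3 == j.+1] -> k <= m -> m < l -> False.
Proof.
by move=> H h0 h1 h2 b2 h3 /and4P[/eqP? /eqP? /eqP? /eqP?] ? ?; subst;
  apply: (H j k m l).
Qed.

Lemma patR i l i1 j i2 l' i3 j3 v w : no_R f ->
  f i l = Bp -> f i1 j = Au -> f i2 l' = v -> is_a v -> f i3 j3 = w -> is_b w ->
  [&& i1 == i, i2 == i.+1, i3 == i.+1 & j3 == j] -> l <= l' -> l' < j -> False.
Proof.
by move=> H h0 h1 h2 a2 h3 b3 /and4P[/eqP? /eqP? /eqP? /eqP?] ? ?; subst;
  apply: (H i j l l').
Qed.

Lemma easternmostP j p q k l w : easternmost f j -> f p q = Au -> f k l = w ->
  is_b w -> (p = k /\ l = q.+1) \/ (k = p.+1 /\ q = l) -> j < q -> False.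
Proof.
move=> ch h1 h2 bw [[? ?]|[? ?]]; subst;
  by have := ch _ _ h1; rewrite /can_switch bw ?orbT => /(_ isT); lia.
Qed.

Lemma southernmost_unprimed i p q k l w : southernmost f i -> f p q = Au ->
  f k l = w -> is_b w -> (p = k /\ l = q.+1) \/ (k = p.+1 /\ q = l) -> False.
Proof.
move=> [ch _] h1 h2 bw [[? ?]|[? ?]]; subst;
  by have := ch _ _ h1; rewrite /can_switch bw ?orbT => /(_ isT).
Qed.

Lemma southernmost_primed i p q k l w : southernmost f i -> f p q = Ap ->
  f k l = w -> is_b w -> (p = k /\ l = q.+1) \/ (k = p.+1 /\ q = l) ->
  i < p -> False.
Proof.
move=> [_ ch] h1 h2 bw [[? ?]|[? ?]]; subst;
  by have := ch _ _ h1; rewrite /can_switch bw ?orbT => /(_ isT); lia.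
Qed.

(* [clash] refutes a set of equations [f i j = v].  [probe p q] distinguishes the
   possible entries of the box (p, q), which must lie between two known boxes.
   [rowsw i j l] and [colsw i j l] find an a-box that can be switched between the
   a-box at position j and the b-box at position l of row i or column i. *)
Ltac tris := repeat match goal with H : f ?p ?q = ?v |- _ =>
  lazymatch v with Out => fail | _ =>
  lazymatch goal with _ : p <= q |- _ => fail | _ =>
    assert (p <= q) by (apply region_tri; rewrite H; discriminate) end end end.
Ltac other_box := match goal with
 | n : (_, _) <> (_, _) |- False => apply n; f_equal; lia end.
Ltac ineq := first [lia | let e := fresh "e" in intro e; other_box].
Ltac pair_clash := match goal with
 | H1 : f ?i ?j = Au, H2 : f ?k ?l = Ap |- _ =>
    exact (nau H1 H2 ltac:(lia) ltac:(lia))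
 | H1 : f ?i ?j = Bu, H2 : f ?k ?l = Bp |- _ =>
    exact (nbu H1 H2 ltac:(lia) ltac:(lia))
 | H1 : f ?i ?j = Au, H2 : f ?k ?j = Au |- _ =>
    exact (colA H1 H2 erefl ltac:(ineq))
 | H1 : f ?i ?j = Bu, H2 : f ?k ?j = Bu |- _ =>
    exact (colB H1 H2 erefl ltac:(ineq))
 | H1 : f ?i ?j = Ap, H2 : f ?i ?l = Ap |- _ =>
    exact (rowA H1 H2 erefl ltac:(ineq))
 | H1 : f ?i ?j = Bp, H2 : f ?i ?l = Bp |- _ =>
    exact (rowB H1 H2 erefl ltac:(ineq))
 | H1 : f ?i ?i = ?v, H2 : f ?k ?k = ?w |- _ =>
    exact (diagA H1 H2 isT isT erefl erefl ltac:(ineq))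
 | H1 : f ?i ?i = ?v, H2 : f ?k ?k = ?w |- _ =>
    exact (diagB H1 H2 isT isT erefl erefl ltac:(ineq))
 | c : easternmost f _, H1 : f ?p ?q = Au, H2 : f ?p ?l = ?w |- _ =>
    exact (easternmostP c H1 H2 isT ltac:(lia) ltac:(lia))
 | c : easternmost f _, H1 : f ?p ?q = Au, H2 : f ?k ?q = ?w |- _ =>
    exact (easternmostP c H1 H2 isT ltac:(lia) ltac:(lia))
 | c : southernmost f _, H1 : f ?p ?q = Au, H2 : f ?p ?l = ?w |- _ =>
    exact (southernmost_unprimed c H1 H2 isT ltac:(lia))
 | c : southernmost f _, H1 : f ?p ?q = Au, H2 : f ?k ?q = ?w |- _ =>
    exact (southernmost_unprimed c H1 H2 isT ltac:(lia))
 | c : southernmost f _, H1 : f ?p ?q = Ap, H2 : f ?p ?l = ?w |- _ =>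
    exact (southernmost_primed c H1 H2 isT ltac:(lia) ltac:(lia))
 | c : southernmost f _, H1 : f ?p ?q = Ap, H2 : f ?k ?q = ?w |- _ =>
    exact (southernmost_primed c H1 H2 isT ltac:(lia) ltac:(lia))
 end.
Ltac pair_clash2 := match goal with
 | H1 : f ?i ?j = Au, H2 : f ?k ?l = Au |- _ =>
    exact (colA H1 H2 ltac:(lia) ltac:(ineq))
 | H1 : f ?i ?j = Bu, H2 : f ?k ?l = Bu |- _ =>
    exact (colB H1 H2 ltac:(lia) ltac:(ineq))
 | H1 : f ?i ?j = Ap, H2 : f ?k ?l = Ap |- _ =>
    exact (rowA H1 H2 ltac:(lia) ltac:(ineq))
 | H1 : f ?i ?j = Bp, H2 : f ?k ?l = Bp |- _ =>
    exact (rowB H1 H2 ltac:(lia) ltac:(ineq))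
 | H1 : f ?i ?j = ?v, H2 : f ?k ?l = ?w |- _ =>
    exact (diagA H1 H2 isT isT ltac:(lia) ltac:(lia) ltac:(lia))
 | H1 : f ?i ?j = ?v, H2 : f ?k ?l = ?w |- _ =>
    exact (diagB H1 H2 isT isT ltac:(lia) ltac:(lia) ltac:(lia))
 | H1 : f ?i ?j = ?v, H2 : f ?k ?l = ?w |- _ =>
    exact (region_thin H1 H2 ltac:(discriminate) ltac:(discriminate)
             ltac:(lia) ltac:(lia))
 | H1 : f ?i ?j = ?v, H2 : f ?k ?l = ?w |- _ =>
    exact (same_box H1 H2 ltac:(discriminate) ltac:(lia) ltac:(lia))
 end.
Ltac boxed := first [assumption |
  match goal with E : f _ _ = _ |- _ => rewrite E; discriminate end].
Ltac eqs := repeat (apply/andP; split); apply/eqP; lia.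
Ltac pats := match goal with
 | h : no_P f, H0 : f ?i0 ?j0 = Ap, H1 : f ?i0 ?j1 = Bu,
   H2 : f ?i2 ?j1 = Ap, H3 : f ?i2 ?j3 = ?w |- _ =>
   exact (patP h H0 H1 H2 H3 isT ltac:(eqs) ltac:(lia))
 | h : no_D f, H0 : f ?i0 ?i0 = ?u, H1 : f ?i1 ?i1 = ?v,
   H2 : f ?i1 ?j2 = ?w |- _ =>
   exact (patD h H0 H1 H2 isT isT isT ltac:(eqs) ltac:(lia))
 | h : no_Q0 f, H0 : f ?i0 ?j0 = Bu, H1 : f ?i1 ?j1 = Ap,
   H2 : f ?i2 ?j0 = ?w |- _ =>
   exact (patQ0 h H0 H1 H2 isT ltac:(boxed) ltac:(eqs) ltac:(eqs)
            ltac:(lia) ltac:(lia))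
 | h : no_Q f, H0 : f ?i0 ?j0 = Bu, H1 : f ?i1 ?j1 = Ap,
   H2 : f ?i2 ?j0 = ?v, H3 : f ?i2 ?j1 = ?w |- _ =>
   exact (patQ h H0 H1 H2 isT H3 isT ltac:(eqs) ltac:(lia) ltac:(lia))
 | h : no_T f, H0 : f ?i0 ?j0 = Au, H1 : f ?i1 ?j1 = Bp,
   H2 : f ?i2 ?j0 = ?w, H3 : f ?i3 ?j1 = Au |- _ =>
   exact (patT h H0 H1 H2 isT H3 ltac:(eqs) ltac:(lia) ltac:(lia))
 | h : no_R f, H0 : f ?i0 ?j0 = Bp, H1 : f ?i0 ?j1 = Au,
   H2 : f ?i2 ?j2 = ?v, H3 : f ?i2 ?j1 = ?w |- _ =>
   exact (patR h H0 H1 H2 isT H3 isT ltac:(eqs) ltac:(lia) ltac:(lia))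
 end.
Ltac norm := repeat match goal with
 | H : ?x = ?x :> nat |- _ => clear H
 | H : ?x = ?x :> cell |- _ => clear H
 | H : is_true true |- _ => clear H
 | H : S ?x = S ?y |- _ => injection H as H; subst
 | H : ?x = ?x -> _ |- _ => specialize (H erefl)
 | H : is_true (is_b (f ?p ?q)) -> _, E : f ?p ?q = ?v |- _ =>
     lazymatch v with Bp => idtac | Bu => idtac end;
     rewrite E in H; specialize (H isT)
 | H : is_true (is_a (f ?p ?q)) -> _, E : f ?p ?q = ?v |- _ =>
     lazymatch v with Ap => idtac | Au => idtac end;
     rewrite E in H; specialize (H isT)
 | H : is_true (is_b ?v) -> _ |- _ =>
     lazymatch v with Bp => idtac | Bu => idtac end; specialize (H isT)
 | H : is_true (is_a ?v) -> _ |- _ =>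
     lazymatch v with Ap => idtac | Au => idtac end; specialize (H isT)
 | H : False |- _ => destruct H
 | H : is_true (is_a ?v) |- _ =>
     lazymatch v with
     | Ap => clear H | Au => clear H | f _ _ => fail | _ => discriminate H end
 | H : is_true (is_b ?v) |- _ =>
     lazymatch v with
     | Bp => clear H | Bu => clear H | f _ _ => fail | _ => discriminate H end
 | H : (?x, ?y) <> (?x, ?y) |- _ => exfalso; exact (H erefl)
 | H : (_, ?x) <> (_, S ?x) |- _ => clear H
 | H : (_, S ?x) <> (_, ?x) |- _ => clear H
 | H : (?x, _) <> (S ?x, _) |- _ => clear H
 | H : (S ?x, _) <> (?x, _) |- _ => clear H
 | H : _ = _ :> cell |- _ => discriminate H
 end.
Ltac clash :=
  exfalso; norm; tris; first [lia | congruence | other_box | pair_clash].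
(* A slower variant, which does not rely on coordinates being syntactically
   equal. *)
Ltac clash2 := exfalso; norm; tris;
  first [lia | congruence | other_box | pair_clash | pats | pair_clash2].
Ltac known p q :=
  let E := fresh "E" in
  destruct (f p q) eqn:E; try congruence; try (solve [clash]).
Ltac inreg p q :=
  match goal with
  | H1 : f ?i ?j = ?v, H2 : f ?k ?l = ?w |- _ =>
    assert (f p q <> Out) by
     (apply (@region_cvx p q i j k l);
       [rewrite H1; discriminate|rewrite H2; discriminate|lia..])
  end.
Ltac probe p q := tris; inreg p q; known p q.
Ltac splits := repeat match goal with
 | H : is_true (is_a (f ?p ?q)) |- _ => let E := fresh "E" in
     destruct (f p q) eqn:E; try discriminate H; clear H
 | H : is_true (is_b (f ?p ?q)) |- _ => let E := fresh "E" in
     destruct (f p q) eqn:E; try discriminate H; clear H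
 end.
Ltac rowsw i j l := let m := fresh "m" in
  destruct (@row_switch i j l) as [m [? ? ? ?]];
    [tris; first [lia | match goal with H : f _ _ = _ |- _ => by rewrite H end] ..|];
  splits; try (solve [clash]).
Ltac colsw i j l := let m := fresh "m" in
  destruct (@col_switch i j l) as [m [? ? ? ?]];
    [tris; first [lia | match goal with H : f _ _ = _ |- _ => by rewrite H end] ..|];
  splits; try (solve [clash]).

(** * Preservation of the patterns by a single switch *)

Ltac unupd := repeat (match goal with
 | E : forall p q, ?g p q = _, H : context [?g ?p ?q] |- _ => rewrite (E p q) in H
 | H : context [upd ?h ?i ?j ?v ?p ?q] |- _ =>
   let E := fresh "E" in let n := fresh "n" in
   destruct (updP h i j v p q) as [[? [? E]]|[n E]];
   rewrite E in H; clear E; subst; norm; try (exfalso; lia)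
 end).

Ltac intro_boxes := lazymatch goal with
 | |- perforated _ Ap _ => apply: (perforatedI is_aP); intros
 | |- perforated _ _ _ => apply: (perforatedI is_bP); intros
 | |- no_unprimed _ => rewrite /no_unprimed /can_switch; move=> ? ? ? /orP[?|?]
 | |- _ => hnf; intros
 end.
(** Cases on the moved entry [v], and on which boxes of the goal the switch has changed, turn
    everything into equations about [f]. Most cases are then refuted at once by a pattern or by two
    clashing boxes. *)
Ltac start v :=
  destruct v; try match goal with H : is_true _ |- _ => discriminate H end;
  intro_boxes; unupd; splits; first [exfalso; pats | clash | idtac].
Ltac start2 v w :=
  destruct w; try match goal with H : is_true _ |- _ => discriminate H end;
  start v.

Ltac split_eq p q tac := destruct (p =P q); [subst; solve [tac]|].

(** Serves [no_D]: by the choice of the switched box, a b-box further east in row i+1 makes (i+1,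
    i+2) a b-box, and then no entry is left for (i, i+2). *)
Ltac diag_east i := match goal with H : f i.+1 ?l = _, _ : i.+1 < ?l |- _ =>
  probe i.+1 i.+2;
  first [solve [split_eq l i.+2 clash; rowsw i.+1 i.+2 l] | probe i i.+2] end.
Ltac diag_b i := match goal with H : f ?k ?l = _, _ : i <= ?k |- _ =>
  split_eq k i clash2; split_eq k i.+1 clash2; solve [clash2] end.
Ltac east_b i j :=
  norm;
  try (match goal with H : f ?p ?p = _, _ : ?p < j |- _ =>
    let j0 := fresh in destruct j as [|j0]; [solve [clash]|];
    probe j0 j0; solve [clash2] end);
  try (match goal with H : f ?p ?p = _, _ : j < ?p |- _ =>
    solve [probe j.+1 j.+1] end);
  try (match goal with H : f ?k ?l = Bp, _ : j <= ?l |- _ =>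
    destruct (l =P j); [subst|exfalso; solve [clash2]] end);
  try (match goal with H : f ?p j = Bu, _ : ?p < i |- _ =>
    probe p j.+1; solve [clash2 | colsw j.+1 p i] end);
  try (match goal with H : f ?k j = _, _ : i < ?k |- _ =>
    probe i.+1 j; solve [clash2 | split_eq k i.+1 clash; colsw j i.+1 k] end);
  match goal with H : f ?k j = _, _ : i <= ?k |- _ =>
    split_eq k i clash; probe i.+1 j;
    solve [clash2 | split_eq k i.+1 clash; colsw j i.+1 k] end.
Ltac south_b i j :=
  norm;
  try (match goal with H : f ?k ?l = Bp, _ : i <= ?k |- _ =>
    destruct (k =P i); [subst|exfalso; solve [clash2]] end);
  match goal with H : f i ?l = Bp |- _ =>
    first [have ? : j < l by lia
          |have ? : j < l by (case: (l =P j) => [?|?]; [subst; clash|lia])];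
    split_eq l j.+1 clash; probe i j.+1; solve [rowsw i j.+1 l] end.
Ltac south_row i j := match goal with H : f i ?q = Bp |- _ =>
  split_eq j i.+1 clash2;
  let j0 := fresh in destruct j as [|j0]; [solve [clash]|];
  probe i.+1 j0; solve [clash2] end.
Ltac east_pA i j :=
  try (match goal with H : f ?p j.+1 = Au, _ : ?p < i |- _ =>
    solve [colsw j.+1 p i] end);
  split_eq i j clash2; probe i.+1 j; clash2.
Ltac east_no_T i j :=
  first [solve [clash2] | match goal with H : f ?k j.+2 = Bp |- _ =>
    split_eq k i clash2; probe k j.+1; clash2 end].
Ltac south_pA i j :=
  first [match goal with H : f ?p ?p = _, _ : ?p < i.+1 |- _ =>
      solve [probe i i] end
    | match goal with H : f ?k ?k = _ |- _ =>
      destruct (k =P i.+2); [subst|]; probe i i.+2; probe i.+1 i.+2; clash2 end].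
Ltac south_pB i j :=
  first [south_b i j | south_row i j].
Ltac south_no_T i j :=
  match goal with H : f ?k _ = Bp, _ : ?k < i.+1 |- _ =>
    destruct (k =P i); [subst|]; clash2 end.
Ltac east_primed_pA i j :=
  match goal with H : f ?p ?q = Au |- _ =>
    destruct (q =P j.+1); [subst|exfalso; solve [clash2]];
    split_eq p i clash; colsw j.+1 p i end.
Ltac south_primed_pA i j :=
  norm; first
    [match goal with H : f ?p ?p = _, _ : ?p < i.+1 |- _ => solve [probe i i] end
    |match goal with H : f ?k ?k = _, _ : i.+1 < ?k |- _ =>
       destruct (k =P i.+2); [subst|]; probe i i.+2; probe i.+1 i.+2;
       solve [clash2] end
    |match goal with H : f i.+1 ?l = Ap, _ : j < ?l |- _ =>
       probe i j.+1; probe i.+1 j.+1; solve [clash2] end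
    |match goal with H : f i.+1 ?l = Ap, _ : ?l < j |- _ =>
       solve [rowsw i.+1 l j] end
    |match goal with H : f ?p ?q = Au |- _ =>
       destruct (p =P i.+1); [subst|exfalso; solve [clash2]];
       split_eq q j clash; rowsw i.+1 q j end].
Ltac south_primed_no_P i j :=
  match goal with H : f i.+1 ?k.+1 = Bu |- _ =>
    destruct (j =P k); [subst; probe i k.+1; solve [clash2]|];
    probe i j.+1; probe i.+1 j.+1; solve [clash2 | rowsw i.+1 j.+1 k.+1] end.

(* The alternatives [t i i] and [t j j] below serve the goals in which one of the
   two coordinates has been substituted by an expression in the other. *)

(** Switches S1 and S5 of an a; [cD] excludes S3. Here [no_T] rules out a second a lower in column
    j+1, [no_Q0] a second b higher in column j, and [no_D] a second b-box further up the main
    diagonal. *)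
Lemma step_east_unprimed (g : grid) (i j : nat) (v : cell) :
  (forall p q, g p q = upd (upd f i j v) i j.+1 Au p q) ->
  f i j = Au -> f i j.+1 = v -> is_b v ->
  (is_b (f i.+1 j) -> v = Bp) ->
  (i = j -> v = Bp -> is_b (f i.+1 j.+1) -> False) ->
  easternmost f j -> stage1 f -> stage1 g.
Proof.
move=> Hg c0 cE bv cS cD ch [_ _ [hP hD hQ hR hT]]; split; [| |split].
- start v;
  first [east_pA i j | east_pA i i | east_pA j j].
- start v;
  first [east_b i j | east_b i i | east_b j j].
- start v.
- start v.
- start v.
- start v; clash2.
- start v;
  first [east_no_T i j | east_no_T i i | east_no_T j j].
Qed.

(** Switches S2 and S6 of an a. A second b' in row i is excluded to the west by [no_R], to the east
    by [cE] and the choice of an easternmost box. The last side condition excludes S4 and S7; if it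
    failed, two a-boxes would meet on the main diagonal. *)
Lemma step_south_unprimed (g : grid) (i j : nat) (v : cell) :
  (forall p q, g p q = upd (upd f i j v) i.+1 j Au p q) ->
  f i j = Au -> f i.+1 j = v -> is_b v ->
  (is_b (f i j.+1) -> f i j.+1 = Bu) ->
  (j = i.+1 -> is_a (f i i) -> False) ->
  easternmost f j -> stage1 f -> stage1 g.
Proof.
move=> Hg c0 cS bv cE cW ch [_ _ [hP hD hQ hR hT]]; split; [| |split].
- start v;
  first [south_pA i j | south_pA i i | south_pA j j].
- start v;
  first [south_pB i j | south_pB i i | south_pB j j].
- start v.
- start v; clash2.
- start v.
- start v.
- start v;
  first [south_no_T i j | south_no_T i i | south_no_T j j].
Qed.

(** Switch S3 of an a. The new b at (i, i+1) has no b' southeast of it: row i has lost its only b',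
    in row i+1 the old entry of (i+1, i+1) forbids one, and lower rows are too far from (i, i) in a
    double border strip. *)
Lemma step_diag_unprimed (g : grid) (i : nat) (v : cell) :
  (forall p q, g p q = upd (upd (upd f i i v) i.+1 i.+1 Au) i i.+1 Bu p q) ->
  f i i = Au -> f i i.+1 = Bp -> f i.+1 i.+1 = v -> is_b v ->
  easternmost f i -> stage1 f -> stage1 g.
Proof.
move=> Hg c0 cE cS bv ch [_ _ [hP hD hQ hR hT]]; split; [| |split].
- start v;
  match goal with H : f ?p i.+1 = Au |- _ =>
    split_eq p i clash; colsw i.+1 p i end.
- start v; diag_b i.
- start v.
- start v; diag_east i.
- start v.
- start v.
- start v; clash2.
Qed.

(** S4 and S7 differ only in the box (i, i+2), which neither changes, so one statement covers both.
    A b' there would clash with the b-box that arrives at (i, i). *)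
Lemma step_corner_unprimed (g : grid) (i : nat) (v w : cell) :
  (forall p q, g p q = upd (upd (upd f i i v) i.+1 i.+1 w) i i.+1 Ap p q) ->
  f i i.+1 = Au -> f i i = w -> is_a w ->
  f i.+1 i.+1 = v -> is_b v -> (is_b (f i i.+2) -> f i i.+2 = Bu) ->
  easternmost f i.+1 -> stage1 f -> stage1 g.
Proof.
move=> Hg c0 cW aw cS bv cE ch [_ _ [hP hD hQ hR hT]]; split; [| |split].
- start2 v w;
  match goal with H : f ?p ?q = Au, _ : ?q <= _ |- _ =>
    split_eq q i.+1 clash2; let m := fresh in
    first [solve [clash2] | destruct i as [|m];
      [solve [clash2]|]; split_eq q m.+1 clash2; probe m m; clash2] end.
- start2 v w;
  norm; first [match goal with H : f ?p i = Bu, _ : ?p < i |- _ =>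
      probe p i.+1; solve [clash2] end
    | try (match goal with H : f ?k ?l = Bp, _ : i <= ?k |- _ =>
        destruct (k =P i); [subst|exfalso; solve [clash2]] end);
      match goal with H : f i ?l = Bp |- _ => split_eq l i clash;
        split_eq l i.+1 clash; split_eq l i.+2 clash; probe i i.+2;
        rowsw i i.+2 l end].
- start2 v w.
- start2 v w; diag_east i.
- start2 v w.
- start2 v w.
- start2 v w; clash2.
Qed.

(** Switches S1 and S5 of an a'. A second b higher in column j is excluded by [no_Q], whose lower
    b-box is here the east neighbor itself. *)
Lemma step_east_primed (g : grid) (i j : nat) (v : cell) :
  (forall p q, g p q = upd (upd f i j v) i j.+1 Ap p q) ->
  f i j = Ap -> f i j.+1 = v -> is_b v ->
  (is_b (f i.+1 j) -> v = Bp) ->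
  (i = j -> v = Bp -> is_b (f i.+1 j.+1) -> False) ->
  southernmost f i -> stage2 f -> stage2 g /\ no_unprimed g.
Proof.
move=> Hg c0 cE bv cS cD ch [_ _ [hP hD hQ]]; split; [split; [| |split]|].
- start v;
  first [east_primed_pA i j | east_primed_pA i i | east_primed_pA j j].
- start v;
  first [east_b i j | east_b i i | east_b j j].
- start v.
- start v.
- start v.
- start v.
Qed.

(** Switches S2 and S6 of an a'. A second a' in row i+1 is excluded to the east by [no_P], to the
    west by the choice of a southernmost box. If j = i+1, then (i, i) is no a-box, as neither a nor
    a' may stand directly west of an a'; so S4 has no primed counterpart. *)
Lemma step_south_primed (g : grid) (i j : nat) (v : cell) :
  (forall p q, g p q = upd (upd f i j v) i.+1 j Ap p q) ->
  f i j = Ap -> f i.+1 j = v -> is_b v ->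
  (is_b (f i j.+1) -> f i j.+1 = Bu) ->
  southernmost f i -> stage2 f -> stage2 g /\ no_unprimed g.
Proof.
move=> Hg c0 cS bv cE ch [_ _ [hP hD hQ]]; split; [split; [| |split]|].
- start v;
  first [south_primed_pA i j | south_primed_pA i i | south_primed_pA j j].
- start v;
  first [south_pB i j | south_pB i i | south_pB j j].
- start v;
  first [south_primed_no_P i j | south_primed_no_P i i | south_primed_no_P j j].
- start v; clash2.
- start v; clash2.
- start v.
Qed.

Lemma step_diag_primed (g : grid) (i : nat) (v : cell) :
  (forall p q, g p q = upd (upd (upd f i i v) i.+1 i.+1 Ap) i i.+1 Bu p q) ->
  f i i = Ap -> f i i.+1 = Bp -> f i.+1 i.+1 = v -> is_b v ->
  southernmost f i -> stage2 f -> stage2 g /\ no_unprimed g.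
Proof.
move=> Hg c0 cE cS bv ch [_ _ [hP hD hQ]]; split; [split; [| |split]|].
- start v;
  norm; first
    [match goal with H : f i.+1 ?l = Ap |- _ =>
       probe i i.+2; probe i.+1 i.+2; solve [clash2] end
    |match goal with H : f ?p ?q = Au |- _ =>
       destruct (q =P i.+1); [subst|exfalso; solve [clash2]];
       split_eq p i clash; split_eq p i.+1 clash; colsw i.+1 p i end].
- start v; diag_b i.
- start v; clash2.
- start v; diag_east i.
- start v; clash2.
- start v.
Qed.

End Step.
End Grid.
From mathcomp Require Import zify.

(** * Shifted diagrams as order ideals *)

Lemma mem_diagram la i j : ((i, j) \in shifted_diagram la) =
  [&& 1 <= i <= size la, i <= j & j < nth 0 la i.-1 + i].
Proof. by []. Qed.

(** Each part drops by at least one, which pays for the growing index. Hence shifted rows end no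
    further east as one goes down. *)
Lemma strict_partition_addn la m n : strict_partition la -> m <= n -> n < size la ->
  nth 0 la n + n <= nth 0 la m + m.
Proof.
move=> /andP[/(sortedP 0) sla _]; elim: n => [|n IH] mn ns.
  by move: mn; rewrite leqn0 => /eqP->.
have [->//|mn'] : m = n.+1 \/ m <= n by lia.
by have /= := sla _ ns; have := IH mn' (ltnW ns); lia.
Qed.

Lemma diagram_ideal la i j k l : strict_partition la ->
  (i, j) \in shifted_diagram la -> 1 <= k -> k <= i -> k <= l -> l <= j ->
  (k, l) \in shifted_diagram la.
Proof.
move=> sla; rewrite !mem_diagram => /and3P[/andP[i0 il] ij jl] k0 ki kl lj.
have := @strict_partition_addn la k.-1 i.-1 sla; lia.
Qed.

(** Supplies row lengths: [find (predC p)] returns the first failure of [p], or N if there is none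
    below N. *)
Lemma initial_segment (p : pred nat) N :
  (forall j, p j.+1 -> p j) -> (forall j, p j -> j < N) ->
  forall j, p j = (j < find (predC p) (iota 0 N)).
Proof.
move=> pS pN j; set r := find _ _.
have rN : r <= N by rewrite -[leqRHS](size_iota 0 N) find_size.
have pdown i k : i <= k -> p k -> p i.
  elim: k => [|k IH]; first by rewrite leqn0 => /eqP->.
  by rewrite leq_eqVlt => /predU1P[->//|ik /pS /IH]; apply.
have [jr|rj] := ltnP j r.
  have := @before_find _ 0 (predC p) (iota 0 N) j jr.
  by rewrite nth_iota ?(leq_trans jr) //= add0n => /negbFE.
have [rlt|] := ltnP r N.
  have := @nth_find _ 0 (predC p) (iota 0 N); rewrite has_find size_iota => /(_ rlt).
  rewrite nth_iota //= add0n => npr.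
  by apply/negP => pj; move: npr; rewrite -/r (pdown _ _ rj pj).
by move=> Nr; apply/negP => /pN; lia.
Qed.

(** The parts are the row lengths counted from the diagonal, and [n] is the number of nonempty
    rows. *)
Lemma ideal_diagram (D : pred box) N :
  (forall i j, (i, j) \in D -> [&& 1 <= i, i <= j & j < N]) ->
  (forall i j k l, (i, j) \in D -> 1 <= k -> k <= i -> k <= l -> l <= j ->
     (k, l) \in D) ->
  exists2 mu, strict_partition mu & D =i shifted_diagram mu.
Proof.
move=> DN Dideal.
pose row i := find (predC (fun j => (i, i + j) \in D)) (iota 0 N).
have rowP i j : 1 <= i -> ((i, i + j) \in D) = (j < row i).
  move=> i0; rewrite /row -initial_segment // => k.
    by move=> Dk; apply: (Dideal _ _ _ _ Dk); lia.
  by move=> /DN; lia.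
pose n := find (predC (fun k => 0 < row k.+1)) (iota 0 N).
(* The box above the last box of row k+2 is one place further from the diagonal in its own row. The
   truncated [.-1] also covers an empty row k+1. *)
have rowS k : row k.+2 <= (row k.+1).-1.
  case e: (row k.+2) => [|r] //.
  have : (k.+2, k.+2 + r) \in D by rewrite rowP // e.
  have -> : k.+2 + r = k.+1 + r.+1 by lia.
  move=> Dm; have : (k.+1, k.+1 + r.+1) \in D by apply: (Dideal _ _ _ _ Dm); lia.
  by rewrite rowP //; lia.
have nP k : (0 < row k.+1) = (k < n).
  rewrite /n -initial_segment // => [j|j]; first by have := rowS j; lia.
  by rewrite -rowP // => /DN; lia.
exists (mkseq (fun k => row k.+1) n).
  apply/andP; split.
    apply/(sortedP 0) => i; rewrite size_mkseq => ilt.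
    by rewrite !nth_mkseq //= ?(ltnW ilt) //; have := rowS i; have := nP i; lia.
  by apply/negP => /mapP[k]; rewrite mem_iota add0n /= -nP => ? ?; lia.
move=> [i j]; rewrite mem_diagram size_mkseq; apply/idP/idP => [Dij|].
  have /and3P[i0 ij jN] := DN _ _ Dij.
  have [m e] : exists m, j = i + m by exists (j - i); lia.
  move: Dij; rewrite e rowP // => mr.
  have [k ek] : exists k, i = k.+1 by exists i.-1; lia.
  have kn : k < n by rewrite -nP -ek; lia.
  by rewrite ek /= nth_mkseq // -ek; lia.
case: i => [|k] //= /and3P[kn kj]; rewrite nth_mkseq // => jr.
have [m e] : exists m, j = k.+1 + m by exists (j - k.+1); lia.
by rewrite e rowP //; lia.
Qed.
(** * Fillings as grids *)

Local Open Scope fset_scope.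
Local Open Scope fmap_scope.

Definition value (U : pair_filling) (c : box) : cell :=
  if U.1.[? c] is Some x then if x.2 then Au else Ap
  else if U.2.[? c] is Some x then if x.2 then Bu else Bp else Out.

Definition grid_of (U : pair_filling) : grid := fun i j => value U (i, j).

(** The bookkeeping under which a cell of the grid determines the entry it came from. *)
Definition labelled a b (U : pair_filling) : Prop :=
  [/\ forall c x, U.1.[? c] = Some x -> x.1 = a,
      forall c x, U.2.[? c] = Some x -> x.1 = b
    & forall c, c \in domf U.1 -> c \notin domf U.2].

Lemma value_in U c : value U c <> Out <-> (c \in domf U.1) || (c \in domf U.2).
Proof.
rewrite /value; case: fndP => [? |?]; first by split=> // _; case: ifP.
by case: fndP => ?; split=> // _; case: ifP.
Qed.

Section Labelled.
Variables (a b : nat) (U : pair_filling).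
Hypothesis lU : labelled a b U.

Lemma is_a_value c : is_a (value U c) = (c \in domf U.1).
Proof.
rewrite /value; case: fndP => [?|?]; first by case: ifP.
by case: fndP => // ?; case: ifP.
Qed.

Lemma is_b_value c : is_b (value U c) = (c \in domf U.2).
Proof.
case: lU => _ _ dU; rewrite /value; case: fndP => [cA|?].
  by rewrite (negbTE (dU _ cA)); case: ifP.
by case: fndP => // ?; case: ifP.
Qed.

Lemma value_Au c : value U c = Au <-> U.1.[? c] = Some (unprimed a).
Proof.
case: lU => la _ _; rewrite /value; split=> [|-> //].
case e: U.1.[? c] => [[k []]|]; [|by []|by case: U.2.[? c] => // -[? []]].
by have /= -> := la _ _ e.
Qed.

Lemma value_Ap c : value U c = Ap <-> U.1.[? c] = Some (primed a).
Proof.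
case: lU => la _ _; rewrite /value; split=> [|-> //].
case e: U.1.[? c] => [[k []]|]; [by []| |by case: U.2.[? c] => // -[? []]].
by have /= -> := la _ _ e.
Qed.

Lemma value_Bu c : value U c = Bu <-> U.2.[? c] = Some (unprimed b).
Proof.
case: lU => _ lb dU; split.
  rewrite /value; case e1: U.1.[? c] => [[? []]|] //.
  by case e: U.2.[? c] => [[k []]|] // _; have /= -> := lb _ _ e.
move=> e; have : c \in domf U.2 by rewrite -fndSome e.
by rewrite -is_b_value /value; case: U.1.[? c] => [[? []]|] //; rewrite e.
Qed.

Lemma value_Bp c : value U c = Bp <-> U.2.[? c] = Some (primed b).
Proof.
case: lU => _ lb dU; split.
  rewrite /value; case e1: U.1.[? c] => [[? []]|] //.
  by case e: U.2.[? c] => [[k []]|] // _; have /= -> := lb _ _ e.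
move=> e; have : c \in domf U.2 by rewrite -fndSome e.
by rewrite -is_b_value /value; case: U.1.[? c] => [[? []]|] //; rewrite e.
Qed.

End Labelled.

Lemma fnd_move (T : filling) c d e : c \in domf T ->
  (move_entry T c d).[? e] =
    if e == d then T.[? c] else if e == c then None else T.[? e].
Proof.
move=> cT; rewrite /move_entry (in_fnd cT) fnd_set fnd_rem1.
by case: eqP => // _; case: eqP.
Qed.

Lemma domf_move (T : filling) c d : c \in domf T ->
  domf (move_entry T c d) = d |` (domf T `\ c).
Proof.
by move=> cT; rewrite /move_entry (in_fnd cT) dom_setf; congr (_ |` _);
  apply/fsetP => e; rewrite mem_remf1 !inE.
Qed.

Section Moves.
Variables (a b : nat) (U : pair_filling) (c d : box).
Hypotheses (lU : labelled a b U) (cA : c \in domf U.1) (dB : d \in domf U.2).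

Lemma neq_ab : c != d.
Proof. by apply/eqP => e; case: lU => _ _ /(_ _ cA); rewrite e dB. Qed.

Lemma labelled_interchange : labelled a b (Defs.interchange U c d).
Proof.
case: lU => la lb dU; split=> [e x|e x|e] /=.
- by rewrite fnd_move //; case: eqP => _; [apply: la|case: eqP => // _; apply: la].
- by rewrite fnd_move //; case: eqP => _; [apply: lb|case: eqP => // _; apply: lb].
- rewrite !domf_move // !inE negb_or negb_and negbK.
  case/predU1P => [->|/andP[ec eA]]; first by rewrite eqxx eq_sym neq_ab.
  by rewrite ec (dU _ eA) orbT.
Qed.

Lemma value_interchange e : value (Defs.interchange U c d) e =
  if e == d then value U c else if e == c then value U d else value U e.
Proof.
have := neq_ab; case: lU => _ _ dU; rewrite /value /= !fnd_move //.
have [x ->] : exists x, U.1.[? c] = Some x by exists U.1.[cA]; apply: in_fnd.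
rewrite (not_fnd (contraL (dU d) dB)).
case: (e =P d) => // _ _.
by case: eqP.
Qed.

End Moves.

Lemma labelled_setA a b (A B : filling) c x : labelled a b (A, B) ->
  c \in domf A -> x.1 = a -> labelled a b (A.[c <- x], B).
Proof.
move=> [la lb dU] cA xa; split=> //= [e y|e].
  by rewrite fnd_set; case: eqP => [_ [<-]|_] //; apply: la.
by rewrite ?dom_setf !inE => /predU1P[->|]; apply: dU.
Qed.

Lemma labelled_setB a b (A B : filling) c x : labelled a b (A, B) ->
  c \in domf B -> x.1 = b -> labelled a b (A, B.[c <- x]).
Proof.
move=> [la lb dU] cB xb; split=> //= [e y|e eA].
  by rewrite fnd_set; case: eqP => [_ [<-]|_] //; apply: lb.
rewrite ?dom_setf !inE negb_or (dU _ eA) andbT.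
by apply: contraL cB => /eqP<-; apply: dU.
Qed.

Lemma value_setA (A B : filling) c x e : value (A.[c <- x], B) e =
  if e == c then if x.2 then Au else Ap else value (A, B) e.
Proof. by rewrite /value /= fnd_set; case: eqP. Qed.

Lemma value_setB a b (A B : filling) c x e : labelled a b (A, B) ->
  c \in domf B -> value (A, B.[c <- x]) e =
  if e == c then if x.2 then Bu else Bp else value (A, B) e.
Proof.
move=> [_ _ dU] cB; rewrite /value /= fnd_set; case: eqP => // ->.
by rewrite (not_fnd (contraL (dU c) cB)).
Qed.

Definition weight (D : {fset box}) := \sum_(c <- D) (c.1 + c.2).

Lemma weight_move (D : {fset box}) c d : c \in D -> d \notin D ->
  c.1 + c.2 < d.1 + d.2 -> weight D < weight (d |` (D `\ c)).
Proof.
move=> cD dD lt; rewrite /weight (big_fsetD1 c) //= big_fsetU1 /= ?ltn_add2r //.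
by rewrite !inE negb_and dD orbT.
Qed.

Lemma weight_subset (D E : {fset box}) : D `<=` E -> weight D <= weight E.
Proof.
move=> sDE; rewrite /weight (big_fsetID _ (mem D) E) /=.
have -> : [fset x in E | x \in D] = D; last exact: leq_addr.
by apply/fsetP => x; rewrite !inE /= andb_idl // => /(fsubsetP sDE).
Qed.

(** * The switching process *)

(** One invariant for both stages: the patterns of the first stage are required only while some
    unprimed a-box can be switched, so the passage to the second stage is automatic. *)
Definition switching_invariant (f : grid) : Prop :=
  [/\ region f, stage2 f
    & forall p q, f p q = Au -> can_switch f p q ->
        [/\ no_Q0 f, no_R f & no_T f]].

Lemma stage1_stage2 f : stage1 f -> stage2 f.
Proof.
move=> [Ha Hb [hP hD hQ _ _]]; split=> //; split=> // i j k k' h1 h2 h3 h4.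
exact: hQ h1 h2 h3 (is_b_in h4).
Qed.

Lemma region_iff f g : (forall i j, f i j <> Out <-> g i j <> Out) ->
  region f -> region g.
Proof.
move=> fg [tri cvx thin]; split=> [i j|i j k l p q|i j] /fg h1; first exact: tri.
  by move=> /fg h2 *; apply/fg; apply: (cvx i j k l).
by move=> /fg h2 /fg; apply: thin.
Qed.

Section Process.
Variables (a b : nat).

Lemma can_switchE U p q : labelled a b U ->
  can_switch (grid_of U) p q =
  (east (p, q) \in domf U.2) || (south (p, q) \in domf U.2).
Proof. by move=> lU; rewrite /can_switch /grid_of !(is_b_value lU). Qed.

Lemma switchableE U c : labelled a b U ->
  switchable U c = is_a (value U c) && can_switch (grid_of U) c.1 c.2.
Proof. by case: c => i j lU; rewrite (can_switchE _ _ lU) is_a_value. Qed.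

Lemma mem_candidates U x c :
  (c \in candidates U x) = switchable U c && (U.1.[? c] == Some x).
Proof. by rewrite !inE /= andbA; congr (_ && _); rewrite /switchable andbA andbb. Qed.

Lemma next_boxP U c : labelled a b U -> is_next_box a U c -> switchable U c /\
  (value U c = Au /\ easternmost (grid_of U) c.2 \/
   value U c = Ap /\ southernmost (grid_of U) c.1).
Proof.
move=> lU; rewrite /is_next_box; case: ifPn => [_|].
  rewrite mem_candidates => /andP[/andP[sc /eqP/(value_Au lU) vc] /forallP mx].
  split=> //; left; split=> // p q fpq sw.
  have pqC : (p, q) \in candidates U (unprimed a).
    by rewrite mem_candidates switchableE // (fpq : value U (p, q) = Au) sw;
      apply/eqP/(value_Au lU).
  by apply/leP; apply: (mx [` pqC]).
rewrite negbK => /eqP no; rewrite mem_candidates.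
move=> /andP[/andP[sc /eqP/(value_Ap lU) vc] /forallP mx].
split=> //; right; split=> //; split=> p q fpq sw.
  have : (p, q) \in candidates U (unprimed a).
    by rewrite mem_candidates switchableE // (fpq : value U (p, q) = Au) sw;
      apply/eqP/(value_Au lU).
  by rewrite no inE.
have pqC : (p, q) \in candidates U (primed a).
  by rewrite mem_candidates switchableE // (fpq : value U (p, q) = Ap) sw;
    apply/eqP/(value_Ap lU).
by apply/leP; apply: (mx [` pqC]).
Qed.

Lemma next_box_exists U c : labelled a b U -> switchable U c ->
  exists d, is_next_box a U d.
Proof.
move=> lU sc; case: (boolP (candidates U (unprimed a) != fset0)) => [ne|ne].
  have [d0 d0C] := fset0Pn _ ne.
  case: (@arg_maxnP _ (FSetSub d0C) xpredT (fun d => (val d).2)) => // d _ dmax.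
  by exists (val d); rewrite /is_next_box ne (valP d); apply/forallP => e; apply: dmax.
have /eqP no := negbNE ne.
have cC : c \in candidates U (primed a).
  rewrite mem_candidates sc /=; move: (sc); rewrite switchableE // => /andP[+ _].
  case/is_aP => [/(value_Ap lU) ->//|/(value_Au lU) e].
  have : c \in candidates U (unprimed a) by rewrite mem_candidates sc e eqxx.
  by rewrite no inE.
case: (@arg_maxnP _ (FSetSub cC) xpredT (fun d => (val d).1)) => // d _ dmax.
by exists (val d); rewrite /is_next_box (negbTE ne) (valP d);
  apply/forallP => e; apply: dmax.
Qed.

Definition good_step (U V : pair_filling) : Prop :=
  [/\ labelled a b V, switching_invariant (grid_of V),
      forall e, value U e <> Out <-> value V e <> Out
    & weight (domf U.1) < weight (domf V.1)].

Lemma good_stepI U V : region (grid_of U) -> labelled a b V ->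
  (forall e, value U e <> Out <-> value V e <> Out) ->
  weight (domf U.1) < weight (domf V.1) ->
  stage1 (grid_of V) \/ stage2 (grid_of V) /\ no_unprimed (grid_of V) ->
  good_step U V.
Proof.
move=> rU lV UV wUV sV; split=> //.
have rV : region (grid_of V) by apply: region_iff rU => i j; apply: UV.
split=> // [|p q fpq sw]; case: sV => [sV|[sV no]] //.
- exact: stage1_stage2.
- by case: sV => _ _ [].
- by case: (no _ _ fpq sw).
Qed.

Lemma good_interchange U c d : labelled a b U -> region (grid_of U) ->
  c \in domf U.1 -> d \in domf U.2 -> c.1 + c.2 < d.1 + d.2 ->
  stage1 (grid_of (Defs.interchange U c d)) \/
    stage2 (grid_of (Defs.interchange U c d)) /\
    no_unprimed (grid_of (Defs.interchange U c d)) ->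
  good_step U (Defs.interchange U c d).
Proof.
move=> lU rU cA dB cd; apply: good_stepI => //; first exact: labelled_interchange.
- move=> e; rewrite (value_interchange lU) //.
  have vc : value U c <> Out by apply/value_in; rewrite cA.
  have vd : value U d <> Out by apply/value_in; rewrite dB orbT.
  by case: eqP => [->|_] //; case: eqP => [->|_].
- rewrite /= domf_move //; apply: weight_move => //.
  by case: lU => _ _ dU; apply: contraL dB; apply: dU.
Qed.

Lemma switch_good U c : labelled a b U -> switching_invariant (grid_of U) ->
  is_next_box a U c -> good_step U (switch a b U c).
Proof.
case: U c => A B [i j] lU [rU sU QRT] /(next_boxP lU)[].
rewrite switchableE //= => /andP[ac sc] vc.
(* An unprimed box about to be switched itself triggers the conditional clause of the invariant. *)
have s1U : value (A, B) (i, j) = Au -> stage1 (grid_of (A, B)).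
  move=> /QRT/(_ sc)[hQ hR hT].
  by case: sU => Ha Hb [hP hD _].
have [Ha Hb _] := sU.
have cA : (i, j) \in domf A by rewrite -(is_a_value (A, B)).
have vB e := is_b_value lU e; have vA e := is_a_value (A, B) e.
have oA e : e \in domf A -> value (A, B) e <> Out.
  by move=> eA; apply/value_in; rewrite eA.
have oB e : e \in domf B -> value (A, B) e <> Out.
  by move=> eB; apply/value_in; rewrite eB orbT.
have disj e : e \in domf A -> e \notin domf B by case: lU => _ _; apply.
have lI := labelled_interchange lU; have vI := value_interchange lU.
rewrite /switch /east /south /next_diag /=.
(* S3 is an interchange with the diagonal neighbor, followed by turning the b' at E into b. *)
case: ifP => [/and3P[/eqP ji /eqP /(value_Bp lU) vE nB]|nS3].
  subst j; have EB : (i, i.+1) \in domf B by rewrite -vB vE.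
  have EB' : (i, i.+1) \in domf (move_entry B (i.+1, i.+1) (i, i)).
    by rewrite domf_move // !inE EB !xpair_eqE (ltn_eqF (ltnSn i)) orbT.
  have lV := labelled_setB (lI _ _ cA nB) EB' (erefl : (unprimed b).1 = b).
  have vV p q : value (move_entry A (i, i) (i.+1, i.+1),
      (move_entry B (i.+1, i.+1) (i, i)).[(i, i.+1) <- unprimed b]) (p, q) =
      upd (upd (upd (grid_of (A, B)) i i (value (A, B) (i.+1, i.+1)))
        i.+1 i.+1 (value (A, B) (i, i))) i i.+1 Bu p q.
    by rewrite (value_setB _ _ (lI _ _ cA nB)) // vI // /upd -!xpair_eqE.
  apply: good_stepI => //.
  - move=> [p q]; rewrite vV /upd -!xpair_eqE.
    case: eqP => [->|_]; first by split=> // _; apply: oB.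
    case: eqP => [->|_]; first by split=> _; [apply: oA|apply: oB].
    case: eqP => [->|_]; first by split=> _; [apply: oB|apply: oA].
    by [].
  - rewrite /= domf_move //; apply: weight_move => //=;
      last by rewrite addSn addnS ltnS leqW.
    by apply: contraL nB; apply: disj.
  - have bn : is_b (value (A, B) (i.+1, i.+1)) by rewrite vB.
    case: vc => [[vc ch]|[vc ch]]; [left|right].
      apply: (step_diag_unprimed rU Ha Hb _ vc vE erefl bn ch (s1U vc)) => p q.
      by rewrite [LHS]vV vc.
    apply: (step_diag_primed rU Ha Hb _ vc vE erefl bn ch sU) => p q.
    by rewrite [LHS]vV vc.
(* S4 and S7 interchange (i, i) with S and then prime the entry of the switched box. The weight sees
   only the interchange. *)
case: ifP => [/and5P[/eqP ji /eqP/(value_Au lU) vu WA SB Eu]|nS4].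
  subst j; have cA' : (i, i.+1) \in domf (move_entry A (i, i) (i.+1, i.+1)).
    by rewrite domf_move // !inE cA !xpair_eqE !(gtn_eqF (ltnSn i)) andbF orbT.
  have lV := labelled_setA (lI _ _ WA SB) cA' (erefl : (primed a).1 = a).
  have vV p q : value ((move_entry A (i, i) (i.+1, i.+1)).[(i, i.+1) <- primed a],
      move_entry B (i.+1, i.+1) (i, i)) (p, q) =
      upd (upd (upd (grid_of (A, B)) i i (value (A, B) (i.+1, i.+1)))
        i.+1 i.+1 (value (A, B) (i, i))) i i.+1 Ap p q.
    by rewrite value_setA vI // /upd -!xpair_eqE.
  apply: good_stepI => //.
  - move=> [p q]; rewrite vV /upd -!xpair_eqE.
    case: eqP => [->|_]; first by split=> // _; apply: oA.
    case: eqP => [->|_]; first by split=> _; [apply: oA|apply: oB].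
    case: eqP => [->|_]; first by split=> _; [apply: oB|apply: oA].
    by [].
  - have -> : domf ((move_entry A (i, i) (i.+1, i.+1)).[(i, i.+1) <- primed a]) =
              (i.+1, i.+1) |` domf A `\ (i, i).
      rewrite dom_setf domf_move //; apply/fsetP => e; rewrite !inE.
      by case: eqP => // ->; rewrite cA !xpair_eqE (gtn_eqF (ltnSn i)) andbF orbT.
    apply: weight_move => //=;
      last by rewrite addSn addnS ltnS leqW.
    by apply: contraL SB; apply: disj.
  - left; case: vc => [[vc ch]|[vc _]]; last by rewrite vc in vu.
    have bS : is_b (value (A, B) (i.+1, i.+1)) by rewrite vB.
    have aW : is_a (value (A, B) (i, i)) by rewrite vA.
    have cE : is_b (value (A, B) (i, i.+2)) -> value (A, B) (i, i.+2) = Bu.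
      by rewrite vB => EB; move: Eu; rewrite EB /= => /eqP/(value_Bu lU).
    apply: (step_corner_unprimed rU Ha Hb _ vc erefl aW erefl bS cE ch (s1U vc)).
    by move=> p q; rewrite [LHS]vV.
have Ival c d : c \in domf A -> d \in domf B -> forall p q,
    grid_of (Defs.interchange (A, B) c d) p q = upd (upd (grid_of (A, B)) c.1 c.2
      (value (A, B) d)) d.1 d.2 (value (A, B) c) p q.
  by move=> cA' dB p q; rewrite [LHS]vI // /upd -!xpair_eqE -!surjective_pairing.
(* The remaining switches are plain interchanges: [goE] serves S1 and S5, [goS] serves S2 and S6. *)
have goE : (i, j.+1) \in domf B ->
    ((i.+1, j) \in domf B -> value (A, B) (i, j.+1) = Bp) ->
    good_step (A, B) (Defs.interchange (A, B) (i, j) (i, j.+1)).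
  move=> EB cS; apply: good_interchange => //=; first by rewrite addnS.
  have bE : is_b (value (A, B) (i, j.+1)) by rewrite vB.
  have cS' : is_b (value (A, B) (i.+1, j)) -> value (A, B) (i, j.+1) = Bp.
    by rewrite vB.
  have cD : i = j -> value (A, B) (i, j.+1) = Bp ->
      is_b (value (A, B) (i.+1, j.+1)) -> False.
    move=> ij /(value_Bp lU) /= vE; rewrite vB /= => nB.
    by move: nS3; rewrite -{}ij in vE nB *; rewrite eqxx vE eqxx nB.
  have gE := Ival _ _ cA EB.
  case: vc => [[vc ch]|[vc ch]]; rewrite vc in gE; [left|right].
    exact: (step_east_unprimed rU Ha Hb gE vc erefl bE cS' cD ch (s1U vc)).
  exact: (step_east_primed rU Ha Hb gE vc erefl bE cS' cD ch sU).
have goS : (i.+1, j) \in domf B ->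
    ((i, j.+1) \in domf B -> value (A, B) (i, j.+1) = Bu) ->
    good_step (A, B) (Defs.interchange (A, B) (i, j) (i.+1, j)).
  move=> SB cE; apply: good_interchange => //=.
  have bS : is_b (value (A, B) (i.+1, j)) by rewrite vB.
  have cE' : is_b (value (A, B) (i, j.+1)) -> value (A, B) (i, j.+1) = Bu.
    by rewrite vB.
  have gS := Ival _ _ cA SB.
  case: vc => [[vc ch]|[vc ch]]; rewrite vc in gS; [left|right].
    have cW : j = i.+1 -> is_a (value (A, B) (i, i)) -> False.
      move=> ji; rewrite vA /= => WA; move: nS4 cE.
      move/(value_Au lU): vc => /= vc'; rewrite ji in vc' SB *.
      rewrite eqxx vc' eqxx WA SB /=.
      by case: (_ \in domf B) => //= /eqP n /(_ isT) /(value_Bu lU).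
    exact: (step_south_unprimed rU Ha Hb gS vc erefl bS cE' cW ch (s1U vc)).
  exact: (step_south_primed rU Ha Hb gS vc erefl bS cE' ch sU).
case: ifP => [/andP[EB SB]|nES].
  case: ifP => [/eqP/(value_Bp lU) vE|/eqP nE]; first exact: goE.
  apply: goS => // _; move: (EB); rewrite -vB => /is_bP[/(value_Bp lU)|] //.
case: ifP => [EB|nE]; first by apply: goE => // SB; rewrite EB SB in nES.
case: ifP => [SB|nS]; first by apply: goS => // EB; rewrite EB SB in nES.
by move: sc; rewrite (can_switchE _ _ lU) /= nE nS.
Qed.

End Process.

(** * Termination and the shape of a fully switched pair *)

Section Result.
Variables (a b : nat) (theta : {fset box}).

Definition state (U : pair_filling) : Prop :=
  [/\ labelled a b U, switching_invariant (grid_of U)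
    & forall c, value U c <> Out <-> c \in theta].

Lemma sigma_state U : state U -> state (sigma a b U) /\
  (fully_switched U \/
   weight (domf U.1) < weight (domf (sigma a b U).1)).
Proof.
move=> sU; have [lU iU oU] := sU; rewrite /sigma.
case: pickP => [c nc|none]; last first.
  split=> //; left=> c; apply/negP => sc.
  have [d nd] := next_box_exists lU sc.
  have [/andP[dA _] _] := next_boxP lU nd.
  by have := none (FSetSub dA); rewrite /= nd.
have [lV iV UV wUV] := switch_good lU iU nc; split; last by right.
by split=> // e; split=> [/UV /oU|/oU /UV].
Qed.

Lemma iter_state U n : state U -> state (iter n (sigma a b) U).
Proof. by move=> sU; elim: n => //= n /sigma_state[]. Qed.

Lemma state_sub U : state U -> domf U.1 `<=` theta.
Proof.
by case=> _ _ oU; apply/fsubsetP => c cA; apply/oU/value_in; rewrite cA.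
Qed.

Lemma process_stops U : state U ->
  exists n, fully_switched (iter n (sigma a b) U).
Proof.
(* Induction on the gap between the weight of the a-boxes and its upper bound, the weight of
   [theta]. *)
have [m] := ubnP (weight theta - weight (domf U.1)).
elim: m U => // m IH U ltm sU; have [sV [fU|wV]] := sigma_state sU.
  by exists 0.
have [|n fn] := IH (sigma a b U) _ sV.
  by have := weight_subset (state_sub sV); lia.
by exists n.+1; rewrite iterSr.
Qed.

Lemma mem_skew la mu c : (c \in skew_diagram la mu) =
  (c \in shifted_diagram la) && (c \notin shifted_diagram mu).
Proof. by []. Qed.

Lemma switched_extends U : skew_shifted_shape theta -> state U ->
  fully_switched U -> extends (domf U.1) (domf U.2).
Proof.
move=> [la [mu [sla smu mula thE]]] [lU [rU _ _] oU] fU.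
have disj c : c \in domf U.1 -> c \notin domf U.2 by case: lU => _ _; apply.
have thU c : (c \in theta) = (c \in domf U.1) || (c \in domf U.2).
  by apply/idP/idP => [/oU/value_in|/value_in/oU].
have stuck i j : is_a (grid_of U i j) -> can_switch (grid_of U) i j -> False.
  move=> aij sw; have := fU (i, j).
  by rewrite (switchableE _ lU) [is_a _]aij sw.
(* This is to be the diagram of the partition that separates the b-boxes from the a-boxes. *)
pose D : pred box := fun c => (c \in shifted_diagram mu) || (c \in domf U.2).
have DE c : (c \in D) = (c \in shifted_diagram mu) || (c \in domf U.2) by [].
have Dla c : c \in D -> c \in shifted_diagram la.
  rewrite DE => /orP[/mula //|cB].
  by have := thU c; rewrite cB orbT thE => /andP[].
(* The first row reaches furthest east, and its columns are below la_1 + 1. *)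
have [||mu' smu' muE] := @ideal_diagram D (nth 0 la 0).+1.
- move=> i j /Dla; rewrite mem_diagram => /and3P[/andP[i0 il] ij jl].
  by have := @strict_partition_addn la 0 i.-1 sla; lia.
- move=> i j k l Dij k0 ki kl lj; rewrite DE; apply/norP => -[nmu nB].
  have kla : (k, l) \in shifted_diagram la by apply: (diagram_ideal _ (Dla _ Dij)).
  have kA : is_a (grid_of U k l).
    rewrite (is_a_value U); have := thU (k, l).
    by rewrite thE (negbTE nB) orbF => <-; apply/andP.
  move: Dij; rewrite DE => /orP[jmu|jB].
    by case/negP: nmu; apply: (diagram_ideal _ jmu).
  have jb : is_b (grid_of U i j) by rewrite (is_b_value lU).
  (* The corner (k, j) joins the a-box (k, l) to the b-box (i, j). If it is an a-box, column j
     contains a switchable box; if it is a b-box, row k does. *)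
  have : grid_of U k j <> Out.
    apply: (region_cvx rU (is_a_in kA) (is_b_in jb)); apply/leP => //.
    exact: leq_trans kl lj.
  have [|na] := boolP (is_a (grid_of U k j)) => [akj _|].
    have [e|ne] := eqVneq k i; first by move: akj jb; rewrite e; case: (grid_of U i j).
    have ki' : (k < i)%coq_nat by apply/ltP; rewrite ltn_neqAle ne.
    have [m [_ _ am bm]] := col_switch rU akj jb ki'.
    by apply: (stuck m j) => //; rewrite /can_switch bm orbT.
  have [bkj _|] := boolP (is_b (grid_of U k j)); last by case: (grid_of U k j) na.
  have [e|ne] := eqVneq l j; first by rewrite -e in na; rewrite kA in na.
  have lj' : (l < j)%coq_nat by apply/ltP; rewrite ltn_neqAle ne.
  have [m [_ _ am bm]] := row_switch rU kA bkj lj'.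
  by apply: (stuck k m) => //; rewrite /can_switch bm.
exists la, mu', mu; split=> //.
- by move=> c cmu; rewrite -muE DE cmu.
- by move=> c; rewrite -muE; apply: Dla.
- move=> c; rewrite mem_skew -muE DE.
  have := thU c; rewrite thE mem_skew; have := disj c.
  case: (c \in domf U.1) => [/(_ isT)/negbTE->|_ /=]; first by rewrite !orbF => ->.
  by case: (c \in domf U.2); [rewrite orbT andbF|rewrite orbF => ->].
- move=> c; rewrite mem_skew -muE DE; have := thU c; rewrite thE mem_skew.
  case: (c \in domf U.2); first by rewrite !orbT => /andP[_ ->].
  by rewrite orbF; case: (c \in shifted_diagram mu).
Qed.

End Result.

(** * Perforated tableaux of skew shape *)

Lemma extends_skew (D E : {fset box}) : extends D E ->
  skew_shifted_shape D /\ skew_shifted_shape E.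
Proof.
by move=> [la [mu [nu [[sla smu snu] numu mula DE EE]]]]; split;
  [exists la, mu | exists mu, nu].
Qed.

Lemma skew_corner (D : {fset box}) i j : skew_shifted_shape D ->
  (i, j) \in D -> (i.+1, j.+1) \in D -> (i, j.+1) \in D.
Proof.
move=> [la [mu [sla smu _ DE]]]; rewrite !DE => /andP[ijl ijm] /andP[njl njm].
have := ijl; rewrite mem_diagram => /and3P[/andP[i0 _] ij _].
apply/andP; split; first by apply: (diagram_ideal _ njl) => //; lia.
by apply: contra ijm => /diagram_ideal; apply=> //; lia.
Qed.

(** The box (i, j+1) decides: with [u] it admits no box of its kind below, with [p] none to the
    west. *)
Lemma no_block g p u (k : pred cell) i j : (forall v, k v <-> v = p \/ v = u) ->
  perforated g p u ->
  k (g i j) -> k (g i j.+1) -> k (g i.+1 j.+1) -> False.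
Proof.
move=> kP [NE C R _] /kP h1 /kP h2 /kP h3.
have uu : g i j.+1 <> u.
  move=> e; case: h3 => h3; first by apply: (NE _ _ _ _ e h3); lia.
  by have := C _ _ _ e h3; lia.
case: h2 => // h2; case: h1 => h1; first by have := R _ _ _ h1 h2; lia.
by apply: (NE _ _ _ _ h1 h2); lia.
Qed.

Lemma perforated_border_strip (D : {fset box}) g p u (k : pred cell) :
  (forall v, k v <-> v = p \/ v = u) -> perforated g p u ->
  (forall i j, k (g i j) = ((i, j) \in D)) -> skew_shifted_shape D ->
  border_strip D.
Proof.
move=> kP pg kD sD; split=> // -[i j] [h1 h2].
by apply: (@no_block g p u k i j); rewrite ?kD //; apply: skew_corner.
Qed.

Lemma primed_le_unprimed a : (primed a <= unprimed a)%O.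
Proof. by rewrite Order.ProdLexiOrder.leEprodlexi /=
  Order.POrderTheory.lexx implybT. Qed.

Lemma perforated_young a (T : filling) g p u : 0 < a ->
  skew_shifted_shape (domf T) -> (forall c x, T.[? c] = Some x -> x.1 = a) ->
  (forall i j, g i j = p <-> T.[? (i, j)] = Some (primed a)) ->
  (forall i j, g i j = u <-> T.[? (i, j)] = Some (unprimed a)) ->
  perforated g p u -> shifted_young_tableau T.
Proof.
move=> a0 sT la gp gu [NE C R _].
(* With a single label, only an unprimed entry northwest of a primed one could break the order. *)
have le i j k l x y : i <= k -> j <= l -> T.[? (i, j)] = Some x ->
    T.[? (k, l)] = Some y -> (x <= y)%O.
  move=> /leP ik /leP jl Tx Ty.
  have := la _ _ Tx; have := la _ _ Ty.
  case: x y Tx Ty => [? x] [? y] Tx Ty /= ey ex; subst.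
  case: x Tx => Tx; case: y Ty => Ty;
    rewrite ?Order.POrderTheory.lexx ?primed_le_unprimed //.
  by have := NE _ _ _ _ (proj2 (gu _ _) Tx) (proj2 (gp _ _) Ty) ik jl.
split=> // [c x /la -> //|i j j' x y jj'|i i' j x y ii'|].
- exact: le.
- by apply: le.
- split=> [i i' j k h1 h2|i j j' k h1 h2].
    have := la _ _ h1 => /= e; subst k.
    exact: C (proj2 (gu _ _) h1) (proj2 (gu _ _) h2).
  have := la _ _ h1 => /= e; subst k.
  exact: R (proj2 (gp _ _) h1) (proj2 (gp _ _) h2).
Qed.

Lemma tableau_perforated theta a (T : filling) g p u :
  (forall i j, g i j = p <-> T.[? (i, j)] = Some (primed a)) ->
  (forall i j, g i j = u <-> T.[? (i, j)] = Some (unprimed a)) ->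
  perforated_tableau theta a T -> perforated g p u.
Proof.
move=> gp gu [_ _ NE [C R] D]; split.
- move=> i j k l /gu h1 /gp h2 /leP ik /leP jl.
  by have := NE _ _ h1 h2; rewrite /southeast /= ik jl.
- by move=> i k j /gu h1 /gu; apply: C.
- by move=> i j l /gp h1 /gp; apply: R.
- have inT i : g i i = p \/ g i i = u -> (i, i) \in domf T.
    by case=> [/gp|/gu] e; rewrite -fndSome e.
  by move=> i k /inT h1 /inT; apply: D.
Qed.

(** * The initial pair and the theorem *)

Lemma strip_region theta U : double_border_strip theta ->
  (forall c, value U c <> Out <-> c \in theta) -> region (grid_of U).
Proof.
move=> [[la [mu [sla smu _ thE]]] thin] oU.
split=> [i j /oU|i j k l p q /oU h1 /oU h2|i j].
- by rewrite thE => /andP[/and3P[_ /leP]].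
- move=> /leP ip /leP pk /leP jq /leP ql /leP pq.
  apply/oU; move: h1 h2; rewrite !thE => /andP[h1 h1'] /andP[h2 _].
  have := h1; rewrite mem_diagram => /and3P[/andP[i0 _] ij _].
  apply/andP; split; first by apply: (diagram_ideal _ h2) => //; lia.
  by apply: contra h1' => /diagram_ideal; apply=> //; lia.
- by move=> /oU h1 /oU h2 /oU h3; apply: (thin (i, j)).
Qed.

Lemma initial_state a b theta A B : perforated_pair theta a b A B ->
  extends (domf B) (domf A) -> state a b theta (A, B).
Proof.
move=> [strip tA tB thE dAB] [la [mu [nu [[sla smu snu] numu mula BE AE]]]].
have lU : labelled a b (A, B).
  split=> /= [c x|c x|c cA].
  - by case: tA => _ vA _ _ _ /vA[->|->].
  - by case: tB => _ vB _ _ _ /vB[->|->].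
  - exact: (fdisjointP dAB).
have oU c : value (A, B) c <> Out <-> c \in theta.
  by rewrite -thE inE; split=> [/value_in|h]; [|apply/value_in].
(* The a-boxes lie in the diagram of [mu], an ideal disjoint from B. Each forbidden pattern has a
   b-box northwest of an a-box, so none occurs. *)
have nw i j k l : is_b (grid_of (A, B) i j) -> is_a (grid_of (A, B) k l) ->
    i <= k -> j <= l -> False.
  rewrite (is_b_value lU) (is_a_value (A, B)) /= BE AE.
  move=> /andP[h1 /negP h2] /andP[h3 _] ik jl; apply: h2.
  have := h1; rewrite mem_diagram => /and3P[/andP[i0 _] ij _].
  by apply: (diagram_ideal _ h3).
have nwu i j v k l w : grid_of (A, B) i j = v -> is_b v ->
    grid_of (A, B) k l = w -> is_a w -> i <= k -> j <= l -> False.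
  by move=> <- h1 <-; apply: nw.
split=> //; split; first exact: strip_region oU.
  split; [| |split].
  - by apply: (tableau_perforated _ _ tA) => i j;
      [apply: (value_Ap lU)|apply: (value_Au lU)].
  - by apply: (tableau_perforated _ _ tB) => i j;
      [apply: (value_Bp lU)|apply: (value_Bu lU)].
  - by move=> i j k _ h1 h2 _ _; apply: (nwu _ _ _ _ _ _ h1 isT h2 isT).
  - by move=> k l h1 h2 _ _; apply: (nw _ _ _ _ h1 h2).
  - move=> i j k k' h1 _ h2 _ /leP kk' /leP k'i.
    by apply: (nwu _ _ _ _ _ _ h1 isT (erefl _) h2); lia.
move=> _ _ _ _; split.
- move=> i j k k' h1 _ h2 _ /leP kk' /leP k'i.
  by apply: (nwu _ _ _ _ _ _ h1 isT (erefl _) h2); lia.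
- move=> i j l l' h1 h2 _ _ /leP ll' /leP l'j.
  by apply: (nwu _ _ _ _ _ _ h1 isT h2 isT); lia.
- move=> j k m l _ h1 _ h2 /leP km /leP ml.
  by apply: (nwu _ _ _ _ _ _ h1 isT h2 isT); lia.
Qed.

Theorem theorem3p5 (a b : nat) (theta : {fset box}) (A B : filling)
  (a_gt0 : 0 < a) (b_gt0 : 0 < b)
  (AB_pair : perforated_pair theta a b A B)
  (B_extends_A : extends (domf B) (domf A)) :
  (exists A_B AB : filling, switching_result a b (A, B) (A_B, AB)) /\
  (forall A_B AB : filling, switching_result a b (A, B) (A_B, AB) ->
    domf AB `|` domf A_B = domf A `|` domf B /\
    [/\ extends (domf A_B) (domf AB),
        shifted_young_tableau A_B, border_strip (domf A_B),
        shifted_young_tableau AB & border_strip (domf AB)]).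
Proof.
have s0 := initial_state AB_pair B_extends_A.
split.
  have [n fn] := process_stops s0.
  exists (iter n (sigma a b) (A, B)).1, (iter n (sigma a b) (A, B)).2.
  by rewrite -surjective_pairing; split=> //; exists n.
move=> A' B' [fV [n eV]].
have sV : state a b theta (A', B') by rewrite eV; apply: iter_state.
have [lV [_ [Ha Hb _] _] oV] := sV; have [la lb _] := lV.
have [[skth _] _ _ thE _] := AB_pair.
have ext := switched_extends skth sV fV; have [skA skB] := extends_skew ext.
split.
  rewrite thE; apply/fsetP => c; rewrite inE orbC.
  by apply/idP/idP => [h|/oV/value_in//]; apply/oV/value_in.
split=> //.
- apply: (perforated_young a_gt0 skA la _ _ Ha) => i j;
    [exact: (value_Ap lV)|exact: (value_Au lV)].
- apply: (perforated_border_strip is_aP Ha) => // i j; exact: (is_a_value (A', B')).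
- apply: (perforated_young b_gt0 skB lb _ _ Hb) => i j;
    [exact: (value_Bp lV)|exact: (value_Bu lV)].
- apply: (perforated_border_strip is_bP Hb) => // i j; exact: (is_b_value lV).
Qed.
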